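(* Let $n\ge 1$, let $X_1,\ldots,X_n$ be i.i.d. uniform on $[0,1]$, let $K(x)=\frac1{\sqrt{2\pi}}e^{-x^2/2}$, and let $h\in(0,1]$, $a\in(0,1/4]$ and $\delta\in(0,1/2)$. For $x\in[a,1-a]$ define $$\hat g(x)=\frac1n\sum_{i=1}^n\frac1hK\left(\frac{X_i-x}h\right),\qquad S(x)=\hat g(x)-\mathbb E[\hat g(x)].$$ Let $N=\left\lfloor1+\frac{1-2a}\delta\right\rfloor$, let $\mathcal X_\delta=(a+(j-1)\delta:1\le j\le N)$, and let $S(\mathcal X_\delta)=(S(x):x\in\mathcal X_\delta)\in\mathbb R^N$. Then the minimum eigenvalue of the $N\times N$ matrix $\Sigma=nh\,\mathrm{Var}[S(\mathcal X_\delta)]$ satisfies $$\lambda_{\min}(\Sigma)\le2e^{-h^2/\delta^2}+\frac h{\pi a\delta}e^{-a^2/h^2}.$$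
   Context: $\mathrm{Var}[\cdot]$ of a random vector denotes its covariance matrix, and $\lambda_{\min}$ its smallest eigenvalue. *)

(* Defs.v *)
From mathcomp Require Import all_boot all_order all_algebra.
From mathcomp Require Import all_classical all_reals all_analysis.
Set Implicit Arguments.
Unset Strict Implicit.
Unset Printing Implicit Defensive.
Import Order.TTheory GRing.Theory Num.Theory.
Import numFieldNormedType.Exports.
Local Open Scope classical_set_scope.
Local Open Scope ring_scope.

Definition mutually_independent (d : measure_display) (T : measurableType d)
    (R : realType) (P : probability T R) (n : nat)
    (X : 'I_n -> {RV P >-> R}) : Prop :=
  forall (J : {set 'I_n}) (A : 'I_n -> set R),
    (forall i, measurable (A i)) ->
    P (\bigcap_(i in [set` J]) X i @^-1` A i)
    = (\prod_(i in J) P (X i @^-1` A i))%E.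

(* The laws are compared on Borel sets only: [uniform_prob] is a Lebesgue
   integral, which carries no meaning on a non-measurable set. *)
Definition uniform01 (d : measure_display) (T : measurableType d)
    (R : realType) (P : probability T R) (X : {RV P >-> R}) : Prop :=
  forall A : set R, measurable A ->
    distribution P X A = uniform_prob (@ltr01 R) A.

Definition gauss_kernel (R : realType) (x : R) : R :=
  (Num.sqrt (2 * pi))^-1 * expR (- (x ^+ 2 / 2)).

Definition kde (d : measure_display) (T : measurableType d) (R : realType)
    (P : probability T R) (n : nat) (X : 'I_n -> {RV P >-> R}) (h x : R) :
    T -> R :=
  fun t => n%:R^-1 * \sum_(i < n) h^-1 * gauss_kernel ((X i t - x) / h).

Definition centered_kde (d : measure_display) (T : measurableType d)
    (R : realType) (P : probability T R) (n : nat) (X : 'I_n -> {RV P >-> R})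
    (h x : R) : T -> R :=
  fun t => kde X h x t - fine 'E_P[kde X h x].

(* [fine] maps infinite covariances to 0; it is harmless for random vectors
   with finite second moments, such as the bounded ones considered here. *)
Definition cov_mx (d : measure_display) (T : measurableType d) (R : realType)
    (P : probability T R) (N : nat) (Y : 'I_N -> T -> R) : 'M[R]_N :=
  \matrix_(i, j) fine (covariance P (Y i) (Y j)).

Definition grid_size (R : realType) (a delta : R) : nat :=
  Num.truncn (1 + (1 - 2 * a) / delta).

(* Indices start at 0, so the j-th point is a + j delta. *)
Definition grid (R : realType) (a delta : R) (j : 'I_(grid_size a delta)) : R :=
  a + j%:R * delta.

(* A relation rather than a function, so that no default value is attached to
   matrices without real eigenvalues. *)
Definition is_min_eigenvalue (R : realType) (N : nat) (A : 'M[R]_N) (l : R) :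
    Prop :=
  eigenvalue A l /\ (forall m : R, eigenvalue A m -> l <= m).

(* Main.v *)
Require Import Defs.
From HB Require Import structures.
From mathcomp Require Import all_boot all_order all_algebra.
From mathcomp Require Import all_classical all_reals all_analysis.
From mathcomp Require Import measurable_realfun ring lra.
Set Implicit Arguments.
Unset Strict Implicit.
Unset Printing Implicit Defensive.
Import Order.TTheory GRing.Theory Num.Theory.
Import numFieldNormedType.Exports.
Local Open Scope classical_set_scope.
Local Open Scope ring_scope.

(* The smallest eigenvalue is at most the Rayleigh quotient of the vector
   c_j = (-1)^j 'C(M, j), 0 <= j <= M < N. By independence, and bounding the
   variance by the second moment and the uniform density by 1, c Sigma c^T is
   at most h times the integral over the whole line of
   (sum_j c_j h^-1 K ((u - x_j) / h))^2, that is
     (4 pi)^(-1/2) sum_(j, k) c_j c_k exp (- (j - k)^2 s),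
   where s = delta^2 / (4 h^2). The double sum q_M(s) is, up to sign, the finite
   difference of order 2M of a Gaussian. The identity
     'C(2M + 2, l + 1) ((M + 1)^2 - (l - M)^2) = (2M + 2) (2M + 1) 'C(2M, l)
   gives
     q_(M+1)' = - (M + 1)^2 q_(M+1) + (2M + 2) (2M + 1) q_M,
   whence 0 <= q_M(s) <= (2M)! / M! s^M for s >= 0 by induction. As
   |c|^2 = 'C(2M, M), the eigenvalue is at most (4 pi)^(-1/2) M! s^M, which is
   at most 4^-M / 2 when M <= h^2 / delta^2. If floor (h^2 / delta^2) < N, take
   M to be this floor: the first term of the bound dominates. Otherwise take
   M = N - 1: the grid is then so fine that a^2 / h^2 <= N / 4, and the second
   term dominates. *)

(** * Finite differences of the Gaussian *)

Section FiniteDifferences.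
Variable R : comPzRingType.

Definition alt_binomial (m j : nat) : R := (-1) ^+ j * 'C(m, j)%:R.

(** The opposite of the usual forward difference: its iterates then have the coefficients
    [alt_binomial], with no global sign. *)
Definition backward_diff (g : nat -> R) (i : nat) : R := g i - g i.+1.

(** Induction on [m] by Pascal's rule. The range may be any [N] above [m] because [alt_binomial m j]
    vanishes for [j > m]. *)
Lemma iter_backward_diffE m N (g : nat -> R) i : (m < N)%N ->
  iter m backward_diff g i = \sum_(j < N) alt_binomial m j * g (i + j)%N.
Proof.
elim: m N i => [|m IH] [//|N] i ltmN.
  rewrite big_ord_recl big1 => [|j _]; last first.
    by rewrite /alt_binomial bin0n /= mulr0 mul0r.
  by rewrite /alt_binomial /= expr0 bin0 !mul1r addn0 addr0.
(* The two sums get [N.+1] and [N] terms, so that they match once the term of index 0 is split off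
   the first. *)
rewrite iterS {1}/backward_diff (IH N.+1 i) ?(IH N i.+1) ?(ltnW ltmN)//.
rewrite !big_ord_recl /alt_binomial !bin0 -addrA -sumrN -big_split /=.
congr (_ + _); apply: eq_bigr => j _;
  rewrite /bump /= add1n binS natrD exprS addSnnS.
ring.
Qed.

Lemma alt_binomial_trunc m N (g : nat -> R) : (m < N)%N ->
  \sum_(j < N) alt_binomial m j * g j = \sum_(j < m.+1) alt_binomial m j * g j.
Proof.
by move=> ltmN; rewrite -(iter_backward_diffE g 0 ltmN) -(iter_backward_diffE g
  0 (ltnSn m)).
Qed.

Lemma alt_binomial_rev m (g : nat -> R) :
  \sum_(j < m.+1) alt_binomial m j * g j
  = (-1) ^+ m * \sum_(j < m.+1) alt_binomial m j * g (m - j)%N.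
Proof.
rewrite mulr_sumr (reindex_inj rev_ord_inj); apply: eq_bigr => j _ /=.
have lejm : (j <= m)%N by rewrite -ltnS.
rewrite subSS /alt_binomial bin_sub// !mulrA; congr (_ * _ * _).
by rewrite -signr_odd oddB// signr_addb !signr_odd.
Qed.

(** A difference of order [2m] is a difference of order [m] applied twice; reversing [k] into
    [m - k] in the inner one yields the sign. *)
Lemma alt_binomial_diff2 m (g : nat -> R) :
  \sum_(j < m.+1) \sum_(k < m.+1)
     alt_binomial m j * alt_binomial m k * g (j + (m - k))%N
  = (-1) ^+ m * \sum_(l < m.*2.+1) alt_binomial m.*2 l * g l.
Proof.
rewrite -(iter_backward_diffE g 0 (ltnSn _)).
rewrite -addnn iterD (iter_backward_diffE _ 0 (ltnSn m)) mulr_sumr.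
apply: eq_bigr => j _; rewrite (iter_backward_diffE _ _ (ltnSn m)) mulrCA.
rewrite (eq_bigr (fun k : 'I__ => alt_binomial m j *
    (alt_binomial m k * g (j + (m - k))%N))) => [|k _]; last by rewrite mulrA.
rewrite -mulr_sumr; congr (_ * _).
rewrite (alt_binomial_rev m (fun k => g (j + (m - k))%N)).
apply: (congr1 ( *%R _)); apply: eq_bigr => k _.
by rewrite add0n subKn// -ltnS.
Qed.

End FiniteDifferences.

Lemma sum_sqr_bin m : (\sum_(j < m.+1) 'C(m, j) ^ 2 = 'C(m.*2, m))%N.
Proof.
rewrite -addnn -binomial.Vandermonde; apply: eq_bigr => j _.
have lejm : (j <= m)%N by rewrite -ltnS.
by rewrite (bin_sub lejm) mulnn.
Qed.

Section GaussianDifference.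
Variable R : realType.

(** This is q_M, the difference of order [2M] centred at [l = M], with the sign that makes it
    nonnegative. *)
Definition gauss_diff (M : nat) (s : R) : R :=
  (-1) ^+ M * \sum_(l < M.*2.+1)
    alt_binomial R M.*2 l * expR (- (l%:R - M%:R) ^+ 2 * s).

(** At 0 every exponential is 1, and a difference of positive order kills constants. This is the
    initial value for the differential equation below. *)
Lemma gauss_diff0 (M : nat) : gauss_diff M.+1 0 = 0.
Proof.
have it0 k : iter k.+1 (@backward_diff R) (fun=> 1) = fun=> 0.
  elim: k => [|k IH]; apply/funext => i;
    first by rewrite /= /backward_diff subrr.
  by rewrite iterS IH /backward_diff subrr.
have := iter_backward_diffE (fun=> 1 : R) 0 (ltnSn M.+1.*2).
rewrite {1}doubleS it0 => h; rewrite /gauss_diff.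
under eq_bigr do rewrite mulr0 expR0.
by rewrite -h mulr0.
Qed.

(** The first factor is (l + 1) (2M + 1 - l), which two absorption identities for binomials turn
    into the right-hand side. *)
Lemma bin_diff_rec M l : (l <= M.*2)%N ->
  ((M.+1 ^ 2)%:R - (l.+1%:R - M.+1%:R) ^+ 2) * 'C(M.+1.*2, l.+1)%:R
  = (M.*2.+2 * M.*2.+1)%:R * 'C(M.*2, l)%:R :> R.
Proof.
move=> leM.
have h1 := mul_bin_diag M.*2.+2 l.
have h2 := mul_bin_down M.*2.+1 l.
have : ((l.+1 * (M.*2.+1 - l)) * 'C(M.+1.*2, l.+1)
  = M.*2.+2 * M.*2.+1 * 'C(M.*2, l))%N.
  by rewrite doubleS mulnAC -h1 /= -!mulnA [('C(_, l) * _)%N]mulnC h2.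
move=> /(congr1 (fun k => k%:R : R)); rewrite -!natrM => <-.
rewrite [in RHS]natrM; congr (_ * _); rewrite [in RHS]natrM natrB;
  last exact: leqW.
rewrite natrX -muln2 -!natr1 natrM; ring.
Qed.

Lemma is_derive_expRM (c s : R) :
  is_derive s 1 (fun t => expR (c * t)) (c * expR (c * s)).
Proof.
have dlin : is_derive s 1 (c \*: id) (c *: (1 : R)) by exact: is_deriveZ.
have -> : (fun t => expR (c * t)) = expR \o (c \*: id) by [].
by apply: is_derive_eq; rewrite mulrC /GRing.scale /= mulr1.
Qed.

(** Each exponential brings down -d^2 = -K + (K - d^2) with K = (M + 1)^2. The part -K reproduces
    the sum, and K - d^2 lowers the order by [bin_diff_rec]. *)
Lemma is_derive_gauss_diff (M : nat) (s : R) :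
  is_derive s 1 (gauss_diff M.+1)
    (- (M.+1 ^ 2)%:R * gauss_diff M.+1 s
     + (M.*2.+2 * M.*2.+1)%:R * gauss_diff M s).
Proof.
have linE : gauss_diff M.+1 = (-1) ^+ M.+1 \*: (\sum_(l < M.+1.*2.+1)
   (fun s : R =>
      alt_binomial R M.+1.*2 l * expR (- (l%:R - M.+1%:R) ^+ 2 * s))).
  by apply/funext => t; rewrite /gauss_diff /= fct_sumE.
have der (l : 'I_M.+1.*2.+1) : is_derive s 1
   (fun s : R => alt_binomial R M.+1.*2 l * expR (- (l%:R - M.+1%:R) ^+ 2 * s))
   (alt_binomial R M.+1.*2 l *
     (- (l%:R - M.+1%:R) ^+ 2 * expR (- (l%:R - M.+1%:R) ^+ 2 * s))).
  exact: is_deriveZ (is_derive_expRM _ _).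
rewrite [X in is_derive _ _ X]linE.
apply: is_derive_eq.
rewrite /GRing.scale /= /gauss_diff.
set K := (M.+1 ^ 2)%:R; set C := (M.*2.+2 * M.*2.+1)%:R.
pose d (l : nat) : R := l%:R - M.+1%:R.
have split_sum :
    \sum_(l < M.+1.*2.+1)
       alt_binomial R M.+1.*2 l * (- d l ^+ 2 * expR (- d l ^+ 2 * s))
    = - K * (\sum_(l < M.+1.*2.+1)
               alt_binomial R M.+1.*2 l * expR (- d l ^+ 2 * s))
      - C * \sum_(l < M.*2.+1)
               alt_binomial R M.*2 l * expR (- (l%:R - M%:R) ^+ 2 * s).
  rewrite (eq_bigr (fun l : 'I__ =>
       - K * (alt_binomial R M.+1.*2 l * expR (- d l ^+ 2 * s))
       + (-1) ^+ l * ((K - d l ^+ 2) * 'C(M.+1.*2, l)%:R)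
         * expR (- d l ^+ 2 * s))); last first.
    by move=> l _; rewrite /alt_binomial; ring.
  rewrite big_split -mulr_sumr; congr (_ + _).
  (* K - d^2 vanishes at both extreme indices; the 2M + 1 inner ones, shifted by one, index the
     difference of order 2M. *)
  rewrite doubleS big_ord_recl big_ord_recr /= -doubleS.
  have -> : K - d 0%N ^+ 2 = 0 by rewrite /K /d natrX; ring.
  have -> : K - d (bump 0 M.*2.+1) ^+ 2 = 0.
    by rewrite /K /d /bump /= add1n -doubleS -muln2 natrM natrX; ring.
  rewrite !(mul0r, mulr0) add0r addr0 mulr_sumr -sumrN.
  apply: eq_bigr => l _; rewrite /bump /= add1n.
  have lel : (l <= M.*2)%N by rewrite -ltnS.
  rewrite /K /d (bin_diff_rec lel) -/C.
  have -> : l.+1%:R - M.+1%:R = l%:R - M%:R :> R by rewrite -!natr1; ring.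
  by rewrite exprS /alt_binomial; ring.
by rewrite split_sum /d exprS; ring.
Qed.

(** Induction on [M] through the differential equation: an integrating factor gives the lower bound;
    dropping the nonpositive term and integrating the bound on q_M gives the upper one. *)
Lemma gauss_diff_bounds (M : nat) (s : R) : 0 <= s ->
  0 <= gauss_diff M s <= ((M.*2)`!%:R / M`!%:R) * s ^+ M.
Proof.
elim: M s => [|M IH] s s0.
  rewrite /gauss_diff big_ord1 /alt_binomial !expr0 bin0 !mulr1 subrr expr0n /=.
  by rewrite oppr0 mul0r expR0 !mul1r ler01 invr1 lexx.
have nneg t : 0 <= t -> 0 <= gauss_diff M.+1 t.
  move=> t0; set K : R := (M.+1 ^ 2)%:R.
  pose F u := gauss_diff M.+1 u * expR (K * u).
  have dF (u : R) : is_derive u 1 F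
      ((M.*2.+2 * M.*2.+1)%:R * gauss_diff M u * expR (K * u)).
    have d1 := is_derive_gauss_diff M u; have d2 := is_derive_expRM K u.
    have d3 : is_derive u 1 F _ := is_deriveM d1 d2.
    by apply: is_derive_eq d3 _; rewrite /GRing.scale /= -/K; ring.
  suff : F 0 <= F t by rewrite /F gauss_diff0 mul0r pmulr_lge0// expR_gt0.
  apply: (@ger0_derive1_ndecry _ F 0) => // [u|].
  - rewrite in_itv /= andbT => u0; rewrite derive1E derive_val.
    have /andP[q0 _] := IH _ (ltW u0).
    by apply: mulr_ge0; [exact: mulr_ge0|exact: expR_ge0].
  - by apply: derivable_within_continuous => u _; exact: ex_derive.
rewrite nneg//= -subr_ge0.
set C : R := (M.*2.+2 * M.*2.+1)%:R.
set c : R := _ / _.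
(* With this constant the derivative of c u^(M+1) is exactly C times the inductive bound on q_M. *)
have cE : c * M.+1%:R = C * ((M.*2)`!%:R / M`!%:R).
  have Mn0 : M`!%:R != 0 :> R by rewrite pnatr_eq0 -lt0n fact_gt0.
  have SMn0 : M.+1%:R != 0 :> R by rewrite pnatr_eq0.
  rewrite /c /C doubleS !factS !natrM; set m := M.+1%:R in SMn0 *; field.
  by rewrite Mn0 nat1r.
pose G u := c * u ^+ M.+1 - gauss_diff M.+1 u.
have dG (u : R) : is_derive u 1 G (c * M.+1%:R * u ^+ M
    - (- (M.+1 ^ 2)%:R * gauss_diff M.+1 u + C * gauss_diff M u)).
  have d1 := is_derive_gauss_diff M u.
  have d2 : is_derive u 1 (fun u : R => u ^+ M.+1) (M.+1%:R * u ^+ M).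
    rewrite -[M in u ^+ M]/(M.+1.-1) -[X in is_derive _ _ X]exprfctE.
    by apply: is_derive_eq; rewrite /GRing.scale /= mulr1.
  have d3 : is_derive u 1 G _ := is_deriveB (is_deriveZ c d2) d1.
  by apply: is_derive_eq d3 _; rewrite /GRing.scale /= -/C; ring.
suff : G 0 <= G s by rewrite /G gauss_diff0 expr0n mulr0 subrr.
apply: (@ger0_derive1_ndecry _ G 0) => // [u|].
- rewrite in_itv /= andbT => u0; rewrite derive1E derive_val.
  have /andP[_ qle] := IH _ (ltW u0).
  rewrite cE -mulrA opprD mulNr opprK addrCA.
  rewrite addr_ge0//; first by rewrite mulr_ge0// nneg// ltW.
  by rewrite subr_ge0 ler_wpM2l.
- by apply: derivable_within_continuous => u _; exact: ex_derive.
Qed.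

(** The bound on q_M in Rayleigh form: the squared norm of the coefficients is 'C(2M, M), and (2M)!
    / M! = M! 'C(2M, M). *)
Lemma alt_binomial_gauss_le (M : nat) (s : R) : 0 <= s ->
  \sum_(j < M.+1) \sum_(k < M.+1)
    alt_binomial R M j * alt_binomial R M k * expR (- ((j%:R - k%:R) ^+ 2 * s))
  <= M`!%:R * s ^+ M * \sum_(j < M.+1) alt_binomial R M j ^+ 2.
Proof.
move=> s0; have /andP[_ qle] := gauss_diff_bounds M s0.
rewrite (_ : \sum_(j < M.+1) alt_binomial R M j ^+ 2 = 'C(M.*2, M)%:R);
  last first.
  rewrite -sum_sqr_bin natr_sum; apply: eq_bigr => j _.
  by rewrite /alt_binomial exprMn -exprM mulnC exprM sqrrN !expr1n mul1r natrX.
rewrite (_ : _ * _ = ((M.*2)`!%:R / M`!%:R) * s ^+ M); last first.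
  have Mn0 : M`!%:R != 0 :> R by rewrite pnatr_eq0 -lt0n fact_gt0.
  have := @bin_fact M.*2 M; rewrite -addnn leq_addr addnK => /(_ isT) <-.
  by rewrite !natrM; field.
rewrite (_ : \sum_(j < _) _ = gauss_diff M s)//.
rewrite /gauss_diff.
rewrite -(alt_binomial_diff2 M (fun l => expR (- (l%:R - M%:R) ^+ 2 * s))).
apply: eq_bigr => j _; apply: eq_bigr => k _; congr (_ * expR _).
have lek : (k <= M)%N by rewrite -ltnS.
by rewrite natrD natrB//; ring.
Qed.

End GaussianDifference.

(** * Rayleigh quotients *)

Lemma continuous_sum (R : realType) (T : topologicalType) (n : nat)
    (f : 'I_n -> T -> R) :
  (forall i, continuous (f i)) -> continuous (fun x => \sum_(i < n) f i x).
Proof.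
move=> cf x; apply: cvg_big => [|i _]; first exact: add_continuous.
exact: cf.
Qed.

Section Rayleigh.
Variables (R : realType) (n : nat).
Implicit Types (A D : 'M[R]_n) (v : 'rV[R]_n).

(** Row vectors match the convention of [eigenvalue]; [quad 1%:M] serves as the squared Euclidean
    norm. *)
Definition quad A v : R := (v *m A *m v^T) 0 0.

Lemma quadE A v : quad A v = \sum_i \sum_j v 0 i * v 0 j * A i j.
Proof.
rewrite /quad mxE exchange_big; apply: eq_bigr => j _ /=.
by rewrite !mxE mulr_suml; apply: eq_bigr => i _; rewrite mulrAC.
Qed.

Lemma quad1E v : quad 1%:M v = \sum_i v 0 i ^+ 2.
Proof. by rewrite /quad mulmx1 mxE; apply: eq_bigr => i _; rewrite mxE. Qed.

Lemma quad1_ge0 v : 0 <= quad 1%:M v.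
Proof. by rewrite quad1E sumr_ge0// => i _; exact: sqr_ge0. Qed.

Lemma quad1_eq0 v : (quad 1%:M v == 0) = (v == 0).
Proof.
rewrite quad1E psumr_eq0; last by move=> i _; exact: sqr_ge0.
apply/allP/eqP => [v0|-> i _]; last by rewrite mxE expr0n /= eqxx.
by apply/rowP => i; rewrite mxE; apply/eqP; rewrite -sqrf_eq0;
  have := v0 i (mem_index_enum _).
Qed.

Lemma quadZ A t v : quad A (t *: v) = t ^+ 2 * quad A v.
Proof. by rewrite /quad linearZ /= -!scalemxAl -scalemxAr !mxE mulrA. Qed.

Lemma quadZmx b A v : quad (b *: A) v = b * quad A v.
Proof. by rewrite /quad -scalemxAr -scalemxAl mxE. Qed.

Lemma continuous_quad A : continuous (quad A).
Proof.
rewrite (_ : quad A = fun v => \sum_i \sum_j v 0 i * v 0 j * A i j); last first.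
  by apply/funext => v; exact: quadE.
apply: continuous_sum => i; apply: continuous_sum => j v.
have cc k : {for v, continuous (fun x : 'rV[R]_n => x 0 k)}.
  exact: coord_continuous.
have c1 := continuousM (cc i) (cc j).
have c2 : {for v, continuous (fun x : 'rV[R]_n => A i j)}.
  exact: cst_continuous.
exact: (continuousM c1 c2).
Qed.

(** Used to turn a minimiser of the Rayleigh quotient into an eigenvector. *)
Lemma psd_ker D v : D^T = D -> (forall u, 0 <= quad D u) -> quad D v = 0 ->
  v *m D = 0.
Proof.
move=> symD psdD qv0.
have bilC (x y : 'rV[R]_n) : x *m D *m y^T = y *m D *m x^T.
  rewrite -{1}symD -{1}(trmxK x) -!trmx_mul mulmxA.
  by apply/matrixP => i j; rewrite mxE !ord1.
(* With w := v D, the inequality 0 <= quad D (v - t w) = - 2 t |w|^2 + O(t^2)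
   forces w = 0. *)
set w := v *m D; apply/eqP; rewrite -quad1_eq0.
have qE t : quad D (v - t *: w) = - (2 * t) * quad 1%:M w + t ^+ 2 * quad D w.
  have -> : quad D (v - t *: w) = quad D v - t * (v *m D *m w^T) 0 0
      - t * (w *m D *m v^T) 0 0 + t ^+ 2 * quad D w.
    have -> : quad D (v - t *: w) = (v *m D *m v^T - t *: (v *m D *m w^T)
       - t *: (w *m D *m v^T) + t ^+ 2 *: (w *m D *m w^T)) 0 0.
      have trE : (v - t *: w)^T = v^T - t *: w^T by rewrite linearB linearZ.
      rewrite /quad trE !mulmxBl !mulmxBr -!scalemxAl -!scalemxAr scalerA
        -expr2.
      by rewrite opprB addrA addrAC.
    rewrite /quad.
    move: (v *m D *m v^T) (v *m D *m w^T) (w *m D *m v^T) (w *m D *m w^T).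
    by move=> p q r u; rewrite !mxE.
  rewrite [w *m D *m v^T]bilC.
  by rewrite qv0 /quad mulmx1 -/w; ring.
set a := quad 1%:M w in qE *; set b := quad D w in qE.
have b0 : 0 <= b by exact: psdD.
(* The minimising [t] would be a / b; the denominator 1 + b avoids the case b = 0 and still gives
   the value - a^2 (2 + b) / (1 + b)^2. *)
have := psdD (v - (a / (1 + b)) *: w); rewrite qE => ge0.
have : 0 <= - (a ^+ 2 * (2 + b)).
  have -> : - (a ^+ 2 * (2 + b)) =
      (- (2 * (a / (1 + b))) * a + (a / (1 + b)) ^+ 2 * b) * (1 + b) ^+ 2.
    by field; apply: lt0r_neq0; rewrite ltr_pwDl.
  by rewrite mulr_ge0// sqr_ge0.
rewrite oppr_ge0 => le0; rewrite -sqrf_eq0 eq_le sqr_ge0 andbT.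
by rewrite -(pmulr_lle0 _ (_ : 0 < 2 + b))//; lra.
Qed.

(** The form attains a minimum [l] on the unit sphere. Then [A - l%:M] is positive semidefinite and
    its form vanishes at the minimiser, which is thus an eigenvector. *)
Lemma min_rayleigh A : (0 < n)%N -> A^T = A ->
  exists2 l, is_min_eigenvalue A l & forall v, l * quad 1%:M v <= quad A v.
Proof.
move=> n0 symA.
pose S := [set v : 'rV[R]_n | quad 1%:M v = 1].
have S0 : S !=set0.
  exists (delta_mx 0 (Ordinal n0)); rewrite /S /= quad1E.
  rewrite (bigD1 (Ordinal n0))//=.
  rewrite big1 ?addr0 ?mxE ?eqxx ?expr1n// => i /negbTE ni.
  by rewrite mxE ni andbF expr0n.
have cS : compact S.
  have cbox : compact [set v : 'rV[R]_n | forall i, v ord0 i \in `[-1, 1]].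
    by apply: (@rV_compact _ _ (fun=> `[(-1 : R), 1]%classic)) => _;
      exact: segment_compact.
  apply: (subclosed_compact _ cbox).
    by apply: (@preimage_closed _ _ (quad 1%:M) [set 1]) => [u _|//];
      exact: continuous_quad.
  move=> v /= vS i; rewrite in_itv /= -ler_norml -(expr_le1 (n := 2))//.
  rewrite real_normK ?num_real// -vS quad1E (bigD1 i)//= lerDl.
  by apply: sumr_ge0 => j _; exact: sqr_ge0.
have [c cinS cmin] :=
  EVT_min_rV S0 cS (continuous_subspaceT (@continuous_quad A)).
have {cinS} cS1 : quad 1%:M c = 1 by move: cinS; rewrite inE.
pose l := quad A c.
have ray v : l * quad 1%:M v <= quad A v.
  have [->|v0] := eqVneq v 0; first by rewrite /quad !mul0mx !mxE mulr0.
  have nv0 : 0 < quad 1%:M v by rewrite lt0r quad1_eq0 v0 quad1_ge0.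
  have : l <= quad A ((Num.sqrt (quad 1%:M v))^-1 *: v).
    apply: cmin; rewrite inE /S /= quadZ exprVn sqr_sqrtr ?mulVf ?gt_eqF//.
    exact: ltW.
  by rewrite quadZ exprVn sqr_sqrtr ?(ltW nv0)// mulrC ler_pdivlMr.
exists l => //.
have qD v : quad (A - l%:M) v = quad A v - l * quad 1%:M v.
  rewrite -(scalemx1 _ l) /quad mulmxBr mulmxBl -scalemxAr -scalemxAl.
  by move: (v *m A *m v^T) (v *m 1%:M *m v^T) => p q; rewrite !mxE.
have cD : c *m (A - l%:M) = 0.
  apply: psd_ker => [|u|]; first by rewrite linearB /= symA tr_scalar_mx.
    by rewrite qD subr_ge0.
  by rewrite qD cS1 mulr1 subrr.
have c0 : c != 0 by rewrite -quad1_eq0 cS1 oner_eq0.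
split.
  apply/eigenvalueP; exists c => //.
  by apply/eqP; rewrite -subr_eq0 -mul_mx_scalar -mulmxBr cD.
move=> m /eigenvalueP[v vA v0].
have nv0 : 0 < quad 1%:M v by rewrite lt0r quad1_eq0 v0 quad1_ge0.
have := ray v; rewrite [quad A v]/quad vA -scalemxAl mxE.
by rewrite (_ : (v *m v^T) 0 0 = quad 1%:M v) ?ler_pM2r// /quad mulmx1.
Qed.

End Rayleigh.

(** * Bounded random variables *)

Section BoundedExpectation.
Context (d : measure_display) (T : measurableType d) (R : realType).
Variable P : probability T R.

(** A class of integrable functions closed under sums and products, which settles every
    integrability condition below. *)
Definition bounded_rv (g : T -> R) : Prop :=
  measurable_fun setT g /\ exists M, forall t, `|g t| <= M.

Lemma bounded_rv_cst c : bounded_rv (fun=> c).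
Proof. by split; [exact: measurable_cst|exists `|c|]. Qed.

Lemma bounded_rvD f g : bounded_rv f -> bounded_rv g ->
  bounded_rv (fun t => f t + g t).
Proof.
move=> [mf [M fM]] [mg [N gN]]; split; first exact: measurable_funD.
by exists (M + N) => t; rewrite (le_trans (ler_normD _ _))// lerD.
Qed.

Lemma bounded_rvM f g : bounded_rv f -> bounded_rv g ->
  bounded_rv (fun t => f t * g t).
Proof.
move=> [mf [M fM]] [mg [N gN]]; split; first exact: measurable_funM.
by exists (M * N) => t; rewrite normrM ler_pM.
Qed.

Lemma bounded_rvZ c f : bounded_rv f -> bounded_rv (fun t => c * f t).
Proof. exact/bounded_rvM/bounded_rv_cst. Qed.

Lemma bounded_rvB f g : bounded_rv f -> bounded_rv g ->
  bounded_rv (fun t => f t - g t).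
Proof.
move=> bf bg; rewrite (_ : (fun t => _) = fun t => f t + -1 * g t).
  by apply: bounded_rvD => //; exact: bounded_rvZ.
by apply/funext => t; rewrite mulN1r.
Qed.

Lemma bounded_rv_sum n (f : 'I_n -> T -> R) : (forall i, bounded_rv (f i)) ->
  bounded_rv (fun t => \sum_(i < n) f i t).
Proof.
elim: n f => [f _|n IH f bf].
  by under eq_fun do rewrite big_ord0; exact: bounded_rv_cst.
under eq_fun do rewrite big_ord_recr.
by apply: bounded_rvD => //; exact: IH.
Qed.

Lemma bounded_rv_integrable f : bounded_rv f -> P.-integrable setT (EFin \o f).
Proof.
move=> [mf [M fM]]; apply: measurable_bounded_integrable => //.
  by rewrite (le_lt_trans (probability_le1 _ _))// ltry.
exists M; split; first exact: num_real.
by move=> x Mx t _ /=; rewrite (le_trans (fM t))// ltW.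
Qed.

Lemma meanD f g : bounded_rv f -> bounded_rv g ->
  \int[P]_t (f t + g t) = \int[P]_t f t + \int[P]_t g t.
Proof. by move=> bf bg; rewrite RintegralD//; exact: bounded_rv_integrable. Qed.

Lemma meanZ c f : bounded_rv f -> \int[P]_t (c * f t) = c * \int[P]_t f t.
Proof. by move=> bf; rewrite RintegralZl//; exact: bounded_rv_integrable. Qed.

Lemma meanB f g : bounded_rv f -> bounded_rv g ->
  \int[P]_t (f t - g t) = \int[P]_t f t - \int[P]_t g t.
Proof. by move=> bf bg; rewrite RintegralB//; exact: bounded_rv_integrable. Qed.

Lemma mean_cst c : \int[P]_t c = c.
Proof.
by rewrite Rintegral_cst// -[fine _]/(fine (P setT)) probability_setT mulr1.
Qed.

Lemma mean_sum n (f : 'I_n -> T -> R) : (forall i, bounded_rv (f i)) ->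
  \int[P]_t (\sum_(i < n) f i t) = \sum_(i < n) \int[P]_t f i t.
Proof.
elim: n f => [f _|n IH f bf].
  by rewrite big_ord0; under eq_Rintegral do rewrite big_ord0; exact: mean_cst.
rewrite big_ord_recr /= -IH//.
under eq_Rintegral do rewrite big_ord_recr.
by rewrite meanD//; exact: bounded_rv_sum.
Qed.

Lemma mean_centeredM f g : bounded_rv f -> bounded_rv g ->
  \int[P]_t ((f t - \int[P]_s f s) * (g t - \int[P]_s g s))
  = \int[P]_t (f t * g t) - (\int[P]_t f t) * (\int[P]_t g t).
Proof.
move=> bf bg; set a := \int[P]_s f s; set b := \int[P]_s g s.
rewrite (_ : (fun t => _) = (fun t => f t * g t - (b * f t + a * (g t - b))));
  last first.
  by apply/funext => t; ring.
have bgb : bounded_rv (fun t => g t - b).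
  by apply: bounded_rvB => //; exact: bounded_rv_cst.
rewrite meanB; [|exact: bounded_rvM|by apply: bounded_rvD; exact: bounded_rvZ].
rewrite meanD; [|exact: bounded_rvZ|exact: bounded_rvZ].
rewrite !meanZ// meanB//; last exact: bounded_rv_cst.
by rewrite mean_cst -/a -/b; ring.
Qed.

Lemma variance_sum_le n (V : 'I_n -> T -> R) (B : R) :
  (forall i, bounded_rv (V i)) ->
  (forall i k, i != k -> \int[P]_t (V i t * V k t)
                         = (\int[P]_t V i t) * (\int[P]_t V k t)) ->
  (forall i, \int[P]_t (V i t ^+ 2) <= B) ->
  \int[P]_t ((\sum_(i < n) (V i t - \int[P]_s V i s)) ^+ 2) <= n%:R * B.
Proof.
move=> bV Vunc VB; pose Z i t := V i t - \int[P]_s V i s.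
have bZ i : bounded_rv (Z i) by apply: bounded_rvB => //; exact: bounded_rv_cst.
under eq_Rintegral => t _.
  rewrite expr2 -/(Z _ _) mulr_suml.
  under eq_bigr => i _ do rewrite mulr_sumr.
  over.
rewrite mean_sum; last by move=> i; apply: bounded_rv_sum => k;
  exact: (bounded_rvM (bZ i) (bZ k)).
rewrite mulr_natl -[in leRHS](card_ord n) -sumr_const ler_sum// => i _.
rewrite mean_sum; last by move=> k; exact: (bounded_rvM (bZ i) (bZ k)).
rewrite (bigD1 i)//= big1 ?addr0 => [|k ki].
  rewrite mean_centeredM// (le_trans _ (VB i))// lerBlDr lerDl.
  by rewrite -expr2 sqr_ge0.
by rewrite mean_centeredM// Vunc 1?eq_sym// subrr.
Qed.

Lemma quad_cov_mx n (Y : 'I_n -> T -> R) (c : 'rV[R]_n) :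
  (forall j, bounded_rv (Y j)) ->
  quad (cov_mx P Y) c
  = \int[P]_t ((\sum_(j < n) c 0 j * (Y j t - \int[P]_s Y j s)) ^+ 2).
Proof.
move=> bY; pose Z j t := Y j t - \int[P]_s Y j s.
have bZ j : bounded_rv (Z j) by apply: bounded_rvB => //; exact: bounded_rv_cst.
have bcZ j : bounded_rv (fun t => c 0 j * Z j t) by exact: bounded_rvZ.
(* Unfolded, both sides are [fine] of the same extended-real integral. *)
have covE j k : cov_mx P Y j k = \int[P]_t (Z j t * Z k t).
  by rewrite mxE covariance.unlock expectation.unlock.
rewrite quadE; under [RHS]eq_Rintegral => t _.
  rewrite expr2 mulr_suml.
  under eq_bigr => i _ do rewrite mulr_sumr.
  over.
rewrite mean_sum; last by move=> i; apply: bounded_rv_sum => k;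
  exact: (bounded_rvM (bcZ i) (bcZ k)).
apply: eq_bigr => j _; rewrite mean_sum; last by move=> k;
  exact: (bounded_rvM (bcZ j) (bcZ k)).
apply: eq_bigr => k _; rewrite covE -meanZ;
  last exact: (bounded_rvM (bZ j) (bZ k)).
by congr Rintegral; apply/funext => t; rewrite mulrACA.
Qed.

End BoundedExpectation.

(** * Products of functions of independent variables *)

Section Independence.
Context (d : measure_display) (T : measurableType d) (R : realType).
Variable P : probability T R.

Lemma mutually_independent_pair n (X : 'I_n -> {RV P >-> R}) (i k : 'I_n)
    (A B : set R) : mutually_independent X -> i != k -> measurable A ->
  measurable B ->
  P (X i @^-1` A `&` X k @^-1` B) = (P (X i @^-1` A) * P (X k @^-1` B))%E.
Proof.
move=> indX ik mA mB; pose C j := if j == i then A else B.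
have mC j : measurable (C j) by rewrite /C; case: ifP.
have := indX [set i; k]%SET C mC.
rewrite (bigD1 i) ?in_set2 ?eqxx//= (bigD1 k); last first.
  by rewrite /= in_set2 eqxx orbT eq_sym.
rewrite big1 /= => [|j]; last first.
  by rewrite in_set2 => /andP[/andP[/orP[|] /eqP ->]]; rewrite eqxx.
have ki : (k == i) = false by rewrite eq_sym; exact: negbTE.
rewrite mule1 /C eqxx ki => <-; congr (P _); apply/seteqP; split => t /=.
  by move=> [Xi Xk] j /=; rewrite in_set2 => /orP[|] /eqP ->; rewrite ?eqxx ?ki.
move=> h; split; first by have := h i; rewrite /= in_set2 !eqxx; exact.
by have := h k; rewrite /= in_set2 eqxx orbT ki; exact.
Qed.

(** The law of the pair agrees with the product of the laws on rectangles, hence everywhere;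
    Tonelli's theorem then separates the integral. *)
Lemma ge0_expectation_indepM (X Y : {RV P >-> R}) (f g : R -> R) :
  (forall A B : set R, measurable A -> measurable B ->
     P (X @^-1` A `&` Y @^-1` B) = (P (X @^-1` A) * P (Y @^-1` B))%E) ->
  measurable_fun setT f -> measurable_fun setT g ->
  (forall x, 0 <= f x) -> (forall x, 0 <= g x) ->
  (\int[P]_t (f (X t) * g (Y t))%:E
   = \int[P]_t (f (X t))%:E * \int[P]_t (g (Y t))%:E)%E.
Proof.
move=> indXY mf mg f0 g0.
have mXY : measurable_fun setT (fun t => (X t, Y t)).
  exact: measurable_fun_pair.
pose XY : {RV P >-> (R * R)%type} :=
  HB.pack (fun t => (X t, Y t)) (isMeasurableFun.Build _ _ _ _ _ mXY).
pose F (z : R * R) : \bar R := (f z.1 * g z.2)%:E.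
have mF : measurable_fun setT F.
  apply/measurable_EFinP; apply: measurable_funM.
    exact: measurableT_comp.
  exact: measurableT_comp.
have F0 z : (0 <= F z)%E by rewrite lee_fin mulr_ge0.
have -> : (\int[P]_t (f (X t) * g (Y t))%:E = \int[distribution P XY]_z F z)%E.
  by rewrite ge0_integral_distribution.
have -> : (\int[distribution P XY]_z F z
    = \int[distribution P X \x distribution P Y]_z F z)%E.
  apply: eq_measure_integral => A mA _; apply/esym.
  by apply: product_measure_unique => //= B C mB mC; rewrite -indXY.
rewrite fubini_tonelli1// /fubini_F /=.
have -> : (\int[P]_t (f (X t))%:E = \int[distribution P X]_x (f x)%:E)%E.
  by rewrite ge0_integral_distribution//; exact/measurable_EFinP.
have -> : (\int[P]_t (g (Y t))%:E = \int[distribution P Y]_y (g y)%:E)%E.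
  by rewrite ge0_integral_distribution//; exact/measurable_EFinP.
rewrite -ge0_integralZr//; last 3 first.
- exact/measurable_EFinP.
- by move=> x _; rewrite lee_fin.
- by apply: integral_ge0 => y _; rewrite lee_fin.
apply: eq_integral => x _; rewrite -ge0_integralZl//.
- exact/measurable_EFinP.
- by move=> y _; rewrite lee_fin.
- by rewrite lee_fin.
Qed.

Lemma bounded_rv_comp (X : {RV P >-> R}) (f : R -> R) (M : R) :
  measurable_fun setT f -> (forall x, `|f x| <= M) ->
  bounded_rv (fun t => f (X t)).
Proof. by move=> mf fM; split; [exact: measurableT_comp|exists M]. Qed.

Lemma mean_indepM (X Y : {RV P >-> R}) (f : R -> R) (M : R) :
  (forall A B : set R, measurable A -> measurable B ->
     P (X @^-1` A `&` Y @^-1` B) = (P (X @^-1` A) * P (Y @^-1` B))%E) ->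
  measurable_fun setT f -> (forall x, `|f x| <= M) ->
  \int[P]_t (f (X t) * f (Y t)) = (\int[P]_t f (X t)) * (\int[P]_t f (Y t)).
Proof.
move=> indXY mf fM.
have bX := bounded_rv_comp X mf fM; have bY := bounded_rv_comp Y mf fM.
have bM : bounded_rv (fun _ : T => M) by exact: bounded_rv_cst.
(* Tonelli's theorem applies to the nonnegative shift of [f] by its bound. *)
pose g x := f x + M.
have mg : measurable_fun setT g by exact: measurable_funD.
have g0 x : 0 <= g x.
  by rewrite /g -lerBlDr sub0r; have := fM x; rewrite ler_norml => /andP[].
have bgX : bounded_rv (fun t => g (X t)) by exact: bounded_rvD.
have bgY : bounded_rv (fun t => g (Y t)) by exact: bounded_rvD.
have fin h : bounded_rv h -> (\int[P]_t (h t)%:E)%E \is a fin_num.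
  by move=> /(bounded_rv_integrable P); exact: integrable_fin_num.
have : \int[P]_t (g (X t) * g (Y t))
  = (\int[P]_t g (X t)) * (\int[P]_t g (Y t)).
  by rewrite /Rintegral ge0_expectation_indepM// fineM//; exact: fin.
rewrite (_ : (fun t => _) = fun t => f (X t) * f (Y t)
    + (M * f (X t) + (M * f (Y t) + M * M))); last first.
  by apply/funext => t; rewrite /g; ring.
have bMY : bounded_rv (fun t => M * f (Y t) + M * M).
  exact/bounded_rvD/bounded_rv_cst/bounded_rvZ.
have bMX : bounded_rv (fun t => M * f (X t)) by exact: bounded_rvZ.
rewrite (meanD P (bounded_rvM bX bY) (bounded_rvD bMX bMY)) (meanD P bMX bMY).
rewrite (meanD P (bounded_rvZ M bY) (bounded_rv_cst T (M * M))) !meanZ//.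
rewrite (meanD P bX bM) (meanD P bY bM) !mean_cst => e.
apply: (addIr (M * \int[P]_t f (X t) + (M * \int[P]_t f (Y t) + M * M))).
by rewrite e; ring.
Qed.

End Independence.

(** * Gaussian kernels and uniform variables *)

Section Gaussian.
Variable R : realType.
Implicit Types h x y u : R.

(** Completing the square: (u - x)^2 + (u - y)^2 = 2 (u - (x + y) / 2)^2 + (x - y)^2 / 2. The normal
    density integrates to 1 over the line. *)
Lemma gauss_kernelM_pdf h x y u : 0 < h ->
  gauss_kernel ((u - x) / h) * gauss_kernel ((u - y) / h)
  = h / (2 * Num.sqrt pi) * expR (- ((x - y) ^+ 2 / (4 * h ^+ 2)))
    * normal_pdf ((x + y) / 2) (h / Num.sqrt 2) u.
Proof.
move=> h0; have hn0 := lt0r_neq0 h0.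
have s2 : Num.sqrt 2 != 0 :> R by rewrite sqrtr_eq0 -ltNge.
rewrite normal_pdfE; last by rewrite mulf_neq0// invr_eq0.
rewrite /normal_peak /normal_fun /gauss_kernel.
have p0 : Num.sqrt pi != 0 :> R by rewrite sqrtr_eq0 -ltNge pi_gt0.
have -> : (h / Num.sqrt 2) ^+ 2 = h ^+ 2 / 2 by rewrite exprMn exprVn sqr_sqrtr.
have -> : Num.sqrt (h ^+ 2 / 2 * pi *+ 2) = h * Num.sqrt pi.
  rewrite (_ : _ *+ 2 = h ^+ 2 * pi); last by rewrite -mulr_natr; field.
  by rewrite sqrtrM ?sqr_ge0// sqrtr_sqr ger0_norm// ltW.
have -> : Num.sqrt (2 * pi) = Num.sqrt 2 * Num.sqrt pi :> R by rewrite sqrtrM.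
rewrite mulrACA -expRD.
rewrite (_ : - _ + - _ = - ((x - y) ^+ 2 / (4 * h ^+ 2))
    + - (u - (x + y) / 2) ^+ 2 / (h ^+ 2 / 2 *+ 2));
      last by rewrite -mulr_natr; field.
rewrite expRD; set A := expR _; set B := expR _.
have ss2 : Num.sqrt 2 ^+ 2 = 2 :> R by rewrite sqr_sqrtr.
rewrite -[X in h / (X * _)]ss2.
by field; rewrite s2 p0 hn0.
Qed.

Lemma measurable_gauss_kernel h x :
  measurable_fun setT (fun u => gauss_kernel ((u - x) / h)).
Proof.
apply: measurable_funM => //; apply: measurableT_comp => //.
apply: measurableT_comp => //; apply: measurable_funM => //.
by apply: measurable_funX; apply: measurable_funM => //; exact: measurable_funB.
Qed.

Lemma normr_gauss_kernel_le u : `|gauss_kernel u| <= (Num.sqrt (2 * pi))^-1.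
Proof.
rewrite normrM ger0_norm ?invr_ge0// ger0_norm ?expR_ge0//.
rewrite ler_piMr ?invr_ge0// -expR0 ler_expR oppr_le0.
by rewrite divr_ge0 ?sqr_ge0.
Qed.

Lemma ge0_expectation_uniform01 (d : measure_display) (T : measurableType d)
    (P : probability T R) (X : {RV P >-> R}) (f : R -> R) :
  uniform01 X -> measurable_fun setT f -> (forall u, 0 <= f u) ->
  (\int[P]_t (f (X t))%:E =
   \int[lebesgue_measure]_(u in `[0%R, 1%R]) (f u)%:E)%E.
Proof.
move=> uX mf f0.
have mfE : measurable_fun setT (fun u => (f u)%:E) by exact/measurable_EFinP.
(* [uniform_prob] lives on [measurableTypeR R], whose display differs from
   that of [R]. *)
have mX : measurable_fun setT (X : T -> measurableTypeR R).
  by move=> _ A mA; exact: (measurable_funPT X measurableT A mA).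
pose Y : {RV P >-> measurableTypeR R} :=
  HB.pack (X : T -> measurableTypeR R) (isMeasurableFun.Build _ _ _ _ _ mX).
transitivity (\int[distribution P Y]_u (f u)%:E)%E.
  by rewrite ge0_integral_distribution.
transitivity (\int[uniform_prob (@ltr01 R)]_u (f u)%:E)%E.
  by apply: eq_measure_integral => A mA _; exact: uX.
by rewrite integral_uniform//= subr0 invr1 mul1e.
Qed.

Lemma mean_sqr_kernel_sum_le (d : measure_display) (T : measurableType d)
    (P : probability T R) (X : {RV P >-> R}) h N (c x : 'I_N -> R) :
  uniform01 X -> 0 < h ->
  \int[P]_t ((\sum_(j < N) c j * gauss_kernel ((X t - x j) / h)) ^+ 2)
  <= h / (2 * Num.sqrt pi) * \sum_(j < N) \sum_(k < N)
       c j * c k * expR (- ((x j - x k) ^+ 2 / (4 * h ^+ 2))).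
Proof.
move=> uX h0.
pose f u := (\sum_(j < N) c j * gauss_kernel ((u - x j) / h)) ^+ 2.
pose w j k := h / (2 * Num.sqrt pi)
  * (c j * c k * expR (- ((x j - x k) ^+ 2 / (4 * h ^+ 2)))).
pose pdf j k := normal_pdf ((x j + x k) / 2) (h / Num.sqrt 2).
have fE u : f u = \sum_(j < N) \sum_(k < N) w j k * pdf j k u.
  rewrite /f expr2 mulr_suml; apply: eq_bigr => j _.
  rewrite mulr_sumr; apply: eq_bigr => k _.
  by rewrite mulrACA gauss_kernelM_pdf// /w /pdf; ring.
have mf : measurable_fun setT f.
  apply: measurable_funX; apply: measurable_sum => j.
  by apply: measurable_funM => //; exact: measurable_gauss_kernel.
have f0 u : 0 <= f u by exact: sqr_ge0.
have int_wpdf j k : (@lebesgue_measure R).-integrable setT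
    (fun u => (w j k * pdf j k u)%:E).
  by under eq_fun do rewrite EFinM; apply: integrableZl => //;
    exact: integrable_normal_pdf.
have int_f : (\int[lebesgue_measure]_u (f u)%:E
  = (\sum_(j < N) \sum_(k < N) w j k)%:E)%E.
  under eq_integral => u _.
    rewrite fE -sumEFin; under eq_bigr => j _ do rewrite -sumEFin.
    over.
  rewrite integral_sum//; last first.
    by move=> j; apply: integrable_sum => [|k _];
      [exact: measurableT|exact: int_wpdf].
  rewrite -sumEFin; apply: eq_bigr => j _.
  rewrite integral_sum// -sumEFin; apply: eq_bigr => k _.
  under eq_integral do rewrite EFinM.
  rewrite integralZl//; last exact: integrable_normal_pdf.
  by rewrite integral_normal_pdf mule1.
have int_le : (\int[P]_t (f (X t))%:E <=
    (\sum_(j < N) \sum_(k < N) w j k)%:E)%E.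
  rewrite ge0_expectation_uniform01// -int_f.
  (* Passing from [0, 1] to the line is done on the whole square, which is nonnegative, since the
     terms of its expansion may be negative. *)
  apply: ge0_subset_integral => //=; first exact/measurable_EFinP.
  by move=> u _; rewrite lee_fin.
rewrite mulr_sumr; under [leRHS]eq_bigr => j _ do rewrite mulr_sumr.
rewrite -lee_fin fineK//.
rewrite ge0_fin_numE; first by rewrite (le_lt_trans int_le)// ltry.
by apply: integral_ge0 => t _; rewrite lee_fin sqr_ge0.
Qed.

End Gaussian.

(** * The covariance form of the kernel density estimator *)

Section KdeCovariance.
Context (d : measure_display) (T : measurableType d) (R : realType).
Variable P : probability T R.

(** The form is n h times the variance of a sum of [n] independent copies of [f], and n h * n * (n
    h)^-2 * h / (2 sqrt pi) = 1 / (2 sqrt pi). *)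
Lemma quad_cov_kde_le n N (X : 'I_n -> {RV P >-> R}) h (x : 'I_N -> R)
    (c : 'rV[R]_N) : (0 < n)%N -> mutually_independent X ->
  (forall i, uniform01 (X i)) -> 0 < h ->
  quad ((n%:R * h) *: cov_mx P (fun j => centered_kde X h (x j))) c
  <= (2 * Num.sqrt pi)^-1 * \sum_(j < N) \sum_(k < N)
       c 0 j * c 0 k * expR (- ((x j - x k) ^+ 2 / (4 * h ^+ 2))).
Proof.
move=> n0 indX uX h0.
have hn0 := lt0r_neq0 h0.
have nn0 : n%:R != 0 :> R by rewrite pnatr_eq0 -lt0n.
pose K j u : R := gauss_kernel ((u - x j) / h).
have bK j (i : 'I_n) : bounded_rv (fun t => K j (X i t)).
  apply: (@bounded_rv_comp _ _ _ _ (X i) (K j) (Num.sqrt (2 * pi))^-1).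
    exact: measurable_gauss_kernel.
  by move=> u; exact: normr_gauss_kernel_le.
have kdeE j t : kde X h (x j) t = \sum_(i < n) (n%:R * h)^-1 * K j (X i t).
  by rewrite /kde mulr_sumr; apply: eq_bigr => i _; rewrite mulrA -invfM.
have bkde j : bounded_rv (kde X h (x j)).
  rewrite (_ : kde X h (x j) = fun t =>
    \sum_(i < n) (n%:R * h)^-1 * K j (X i t)).
    by apply: bounded_rv_sum => i; exact: bounded_rvZ.
  by apply/funext => t; exact: kdeE.
pose f u : R := (n%:R * h)^-1 * \sum_(j < N) c 0 j * K j u.
have bf (i : 'I_n) : bounded_rv (fun t => f (X i t)).
  by apply: bounded_rvZ; apply: bounded_rv_sum => j; exact: bounded_rvZ.
have [mf [M fM]] : @bounded_rv _ R R f.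
  apply: bounded_rvZ; apply: bounded_rv_sum => j; apply: bounded_rvZ.
  split; first exact: measurable_gauss_kernel.
  by exists (Num.sqrt (2 * pi))^-1 => u; exact: normr_gauss_kernel_le.
pose V i t := f (X i t).
have sumE t : \sum_(j < N) c 0 j * kde X h (x j) t = \sum_(i < n) V i t.
  under eq_bigr => j _ do rewrite kdeE mulr_sumr.
  rewrite exchange_big; apply: eq_bigr => i _.
  by rewrite /V /f mulr_sumr; apply: eq_bigr => j _; rewrite mulrCA.
have meanE : \sum_(j < N) c 0 j * \int[P]_t kde X h (x j) t
    = \sum_(i < n) \int[P]_t V i t.
  rewrite -mean_sum//; under [RHS]eq_Rintegral do rewrite -sumE.
  rewrite mean_sum; last by move=> j; exact: bounded_rvZ.
  by apply: eq_bigr => j _; rewrite meanZ.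
have bY j : bounded_rv (centered_kde X h (x j)).
  by apply: bounded_rvB => //; exact: bounded_rv_cst.
rewrite quadZmx quad_cov_mx//.
under eq_Rintegral => t _.
  rewrite (_ : \sum_(j < N) _ = \sum_(i < n) (V i t - \int[P]_s V i s));
    last first.
    rewrite !sumrB -sumE -meanE -sumrB; apply: eq_bigr => j _.
    rewrite -mulrBr meanB//; last exact: bounded_rv_cst.
    by rewrite mean_cst /centered_kde; congr (_ * _); ring.
  over.
set S := \sum_(j < N) _.
pose B := ((n%:R * h)^-1) ^+ 2 * (h / (2 * Num.sqrt pi) * S).
have VB i : \int[P]_t (V i t ^+ 2) <= B.
  under eq_Rintegral do rewrite exprMn.
  rewrite meanZ; last first.
    by apply: bounded_rvM; apply: bounded_rv_sum => j; exact: bounded_rvZ.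
  by rewrite ler_wpM2l ?sqr_ge0// mean_sqr_kernel_sum_le.
have unc i k : i != k -> \int[P]_t (V i t * V k t)
    = (\int[P]_t V i t) * (\int[P]_t V k t).
  move=> ik; apply: mean_indepM mf fM => A C mA mC.
  exact: mutually_independent_pair.
have := variance_sum_le bf unc VB.
rewrite -(ler_pM2l (_ : 0 < n%:R * h)); last by rewrite mulr_gt0 ?ltr0n.
move=> /le_trans; apply.
rewrite /B (_ : _ * _ = (2 * Num.sqrt pi)^-1 * S)//.
have p0 : Num.sqrt pi != 0 :> R by rewrite sqrtr_eq0 -ltNge pi_gt0.
by field; rewrite p0 nn0 hn0.
Qed.

End KdeCovariance.

(** * Choice of the order of the difference *)

Section Numerics.
Variable R : realType.

Lemma fact_le_exp M : (M`! <= M ^ M)%N.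
Proof.
elim: M => // -[//|M] IH.
by rewrite factS expnS leq_mul2l /= (leq_trans IH)// leq_exp2r.
Qed.

Lemma exp4V_le_expRN n : (4 ^+ n)^-1 <= expR (- n%:R) :> R.
Proof.
have e1 : 4^-1 <= expR (-1) :> R.
  (* Squaring exp (-1/2) >= 1/2 gives exp (-1) >= 1/4. *)
  have := expR_ge1Dx (- 2^-1 : R); set y := expR _ => hy.
  have -> : expR (-1) = y ^+ 2 :> R by rewrite -expRM_natl; congr expR; field.
  rewrite (_ : 4^-1 = (2^-1) ^+ 2); last by field.
  by rewrite ler_pXn2r// ?nnegrE ?invr_ge0 ?expR_ge0//; lra.
rewrite -exprVn (_ : - n%:R = n%:R * -1); last by rewrite mulrN1.
by rewrite expRM_natl lerXn2r// ?nnegrE ?expR_ge0 ?invr_ge0.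
Qed.

(** Because M! <= M^M <= x^M. *)
Lemma fact_exp_le M (x : R) : M%:R <= x ->
  M`!%:R * (4 * x)^-1 ^+ M <= (4 ^+ M)^-1.
Proof.
case: M => [|M] Mx; first by rewrite !expr0 invr1 mul1r.
have x0 : 0 < x by rewrite (lt_le_trans _ Mx).
rewrite invfM exprMn exprVn mulrCA ler_piMr ?invr_ge0 ?exprn_ge0//.
rewrite exprVn ler_pdivrMr ?exprn_gt0// mul1r.
rewrite (@le_trans _ _ (M.+1%:R ^+ M.+1))//.
  by rewrite -natrX ler_nat fact_le_exp.
by rewrite lerXn2r// ?nnegrE ?ler0n// ltW.
Qed.

Lemma exists_order (h a delta : R) : 0 < h <= 1 -> 0 < a <= 1 / 4 ->
    0 < delta < 1 / 2 ->
  exists2 M, (M < grid_size a delta)%N &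
    (2 * Num.sqrt pi)^-1 * (M`!%:R * (delta ^+ 2 / (4 * h ^+ 2)) ^+ M)
    <= 2 * expR (- (h ^+ 2 / delta ^+ 2))
       + h / (pi * a * delta) * expR (- (a ^+ 2 / h ^+ 2)).
Proof.
move=> /andP[h0 h1] /andP[a0 a1] /andP[d0 d1].
pose x := h ^+ 2 / delta ^+ 2.
have x0 : 0 < x by rewrite divr_gt0 ?exprn_gt0.
have sqrtpi : (2 * Num.sqrt pi)^-1 <= 2^-1 :> R.
  rewrite lef_pV2 ?posrE ?mulr_gt0 ?sqrtr_gt0 ?pi_gt0// ler_peMr//.
  by rewrite -[leLHS]sqrtr1 ler_sqrt ?pi_ge0// (le_trans _ (@pi_ge2 R))// ler1n.
have spos : 0 <= (2 * Num.sqrt pi)^-1 :> R by rewrite invr_ge0 mulr_ge0.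
have -> : delta ^+ 2 / (4 * h ^+ 2) = (4 * x)^-1.
  by rewrite /x; field; rewrite !lt0r_neq0.
have bound M : M%:R <= x ->
    (2 * Num.sqrt pi)^-1 * (M`!%:R * (4 * x)^-1 ^+ M) <= 2^-1 * (4 ^+ M)^-1.
  move=> Mx; apply: ler_pM => //; last exact: fact_exp_le.
  by rewrite mulr_ge0// exprn_ge0// invr_ge0 mulr_ge0// ltW.
have B0 : 0 <= h / (pi * a * delta) by rewrite divr_ge0 ?mulr_ge0 ?pi_ge0// ltW.
have P1 : 0 <= 2 * expR (- x) by rewrite mulr_ge0 ?expR_ge0.
have P2 : 0 <= h / (pi * a * delta) * expR (- (a ^+ 2 / h ^+ 2)).
  exact: (mulr_ge0 B0 (expR_ge0 _)).
have /andP[Mx xM] := truncn_itv (ltW x0).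
have [MN|NM] := ltnP (Num.truncn x) (grid_size a delta).
  exists (Num.truncn x) => //; rewrite (le_trans (bound _ Mx))//.
  rewrite -[leLHS]addr0 (lerD _ P2)//.
  (* As 4^-M / 2 = 2 * 4^-(M + 1), the exponent M + 1 > x becomes available. *)
  rewrite (@le_trans _ _ (2 * (4 ^+ (Num.truncn x).+1)^-1))//.
    by rewrite exprS invfM mulrA ler_wpM2r ?invr_ge0 ?exprn_ge0//; lra.
  rewrite ler_pM2l// (le_trans (exp4V_le_expRN _))// ler_expR lerN2.
  exact: ltW.
set N := grid_size a delta in NM *.
have Ny : (1 - 2 * a) / delta < N%:R.
  have : 0 <= 1 + (1 - 2 * a) / delta.
    by rewrite addr_ge0// divr_ge0// ?(ltW d0)//; lra.
  by move=> /truncn_itv /andP[_]; rewrite -natr1 -/(grid_size a delta) -/N; lra.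
(* Here a <= 1/4 gives 1 - 2 a >= 1/2; then delta < 1/2 forces N > 1. *)
have Nd : 1 / 2 < N%:R * delta by move: Ny; rewrite ltr_pdivrMr//; lra.
have N1 : (1 < N)%N by rewrite -(ltr_nat R); nra.
have Nx : N%:R <= x by rewrite (le_trans _ Mx)// ler_nat.
have N1E : N.-1%:R = N%:R - 1 :> R by rewrite -subn1 natrB// ltnW.
exists N.-1; first by rewrite ltn_predL ltnW.
rewrite (le_trans (bound _ _))//; first by rewrite N1E; lra.
rewrite -[leLHS]add0r (lerD P1)//.
have hd : N%:R * delta ^+ 2 <= h ^+ 2.
  by move: Nx; rewrite /x ler_pdivlMr ?exprn_gt0.
have N2 : 2 <= N%:R :> R by rewrite ler_nat.
have dh : delta <= h by nra.
have coef : 1 <= h / (pi * a * delta).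
  have pi4 : pi <= 4 :> R by have := @pihalf_lt2 R; lra.
  have pa : pi * a <= 1 by have := @pi_ge0 R; nra.
  rewrite ler_pdivlMr ?mulr_gt0 ?pi_gt0// mul1r (le_trans _ dh)//.
  by rewrite ler_piMl// ltW.
(* From h^2 >= (N delta)^2 / N >= 1 / (4 N) and a^2 <= 1/16, the quotient is at most N / 4, which is
   at most N - 1 for N >= 2. *)
have ah : a ^+ 2 / h ^+ 2 <= N.-1%:R.
  by rewrite N1E ler_pdivrMr ?exprn_gt0//; nra.
rewrite (@le_trans _ _ (expR (- N.-1%:R)))//.
  rewrite (le_trans _ (exp4V_le_expRN _))// ler_piMl ?invr_ge0 ?exprn_ge0//;
    lra.
rewrite (@le_trans _ _ (expR (- (a ^+ 2 / h ^+ 2))))//.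
  by rewrite ler_expR lerN2.
by rewrite ler_peMl// expR_ge0.
Qed.

End Numerics.

(** * The bound on the smallest eigenvalue *)

Lemma trmx_cov_mx (d : measure_display) (T : measurableType d) (R : realType)
    (P : probability T R) (N : nat) (Y : 'I_N -> T -> R) :
  (cov_mx P Y)^T = cov_mx P Y.
Proof. by apply/matrixP => i j; rewrite !mxE covarianceC. Qed.

Lemma min_eigenvalue_kde_le (d : measure_display) (T : measurableType d)
    (R : realType) (P : probability T R) (n : nat) (X : 'I_n -> {RV P >-> R})
    (N M : nat) (h a delta : R) : (0 < n)%N -> mutually_independent X ->
    (forall i, uniform01 (X i)) -> 0 < h -> (M < N)%N ->
  exists2 l, is_min_eigenvalue ((n%:R * h) *:
      cov_mx P (fun j : 'I_N => centered_kde X h (a + j%:R * delta))) l &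
    l <= (2 * Num.sqrt pi)^-1 * (M`!%:R * (delta ^+ 2 / (4 * h ^+ 2)) ^+ M).
Proof.
move=> n0 indX uX h0 MN; set Sigma := _ *: _.
have [l minl ray] : exists2 l, is_min_eigenvalue Sigma l &
    forall v, l * quad 1%:M v <= quad Sigma v.
  apply: min_rayleigh; first exact: leq_ltn_trans MN.
  by rewrite linearZ /= trmx_cov_mx.
exists l => //.
(* The entries beyond [M] are zero, so sums over [N] truncate to [M.+1] terms. *)
pose c : 'rV[R]_N := \row_j alt_binomial R M j.
pose s := delta ^+ 2 / (4 * h ^+ 2).
have s0 : 0 <= s by rewrite divr_ge0 ?sqr_ge0// mulr_ge0 ?sqr_ge0.
set Q := \sum_(j < M.+1) alt_binomial R M j ^+ 2.
have cQ : quad 1%:M c = Q.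
  rewrite quad1E /Q; under eq_bigr do rewrite mxE expr2.
  under [RHS]eq_bigr do rewrite expr2.
  exact: (alt_binomial_trunc _ MN).
have Q0 : 0 < Q.
  rewrite /Q big_ord_recl /alt_binomial expr0 bin0 mul1r expr1n.
  by rewrite ltr_wpDr// sumr_ge0// => j _; exact: sqr_ge0.
have := ray c; rewrite cQ.
move=> /le_trans /(_ (quad_cov_kde_le _ _ n0 indX uX h0)) le1.
rewrite -(ler_pM2r Q0) (le_trans le1)// -mulrA ler_wpM2l ?invr_ge0 ?mulr_ge0//.
rewrite (le_trans _ (alt_binomial_gauss_le M s0))//.
rewrite le_eqVlt; apply/predU1P; left.
pose e (j k : nat) : R := expR (- ((j%:R - k%:R) ^+ 2 * s)).
(* The offset [a] cancels in differences of grid points, leaving (j - k)^2 s in the exponent. *)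
transitivity (\sum_(j < N)
  alt_binomial R M j * \sum_(k < N) alt_binomial R M k * e j k).
  apply: eq_bigr => j _; rewrite mulr_sumr; apply: eq_bigr => k _.
  rewrite !mxE /e mulrA; congr (_ * expR _).
  by rewrite /s; field; exact: lt0r_neq0.
rewrite (alt_binomial_trunc
  (fun j => \sum_(k < N) alt_binomial R M k * e j k) MN).
apply: eq_bigr => j _; rewrite (alt_binomial_trunc (e j) MN) mulr_sumr.
by apply: eq_bigr => k _; rewrite mulrA.
Qed.

Theorem lemma3p1 (d : measure_display) (T : measurableType d) (R : realType)
    (P : probability T R) (n : nat) (X : 'I_n -> {RV P >-> R})
    (h a delta : R)
    (n_ge1 : (1 <= n)%N)
    (X_indep : mutually_independent X)
    (X_unif : forall i, uniform01 (X i))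
    (h_bounds : 0 < h <= 1)
    (a_bounds : 0 < a <= 1 / 4)
    (delta_bounds : 0 < delta < 1 / 2) :
  let Sigma : 'M[R]_(grid_size a delta) :=
    (n%:R * h) *:
      cov_mx P (fun j => centered_kde X h (@grid R a delta j)) in
  exists2 lambda_min : R, is_min_eigenvalue Sigma lambda_min &
    lambda_min <= 2 * expR (- (h ^+ 2 / delta ^+ 2))
                  + h / (pi * a * delta) * expR (- (a ^+ 2 / h ^+ 2)).
Proof.
move=> Sigma; have /andP[h0 _] := h_bounds.
have [M MN bound] := exists_order h_bounds a_bounds delta_bounds.
have [l minl lle] := min_eigenvalue_kde_le a delta n_ge1 X_indep X_unif h0 MN.
by exists l => //; exact: le_trans lle bound.
Qed.
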